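(* Let $\psi_L = \sum_{i=1}^{\infty} 1/L_i$. Then the reciprocal Lucas series converges exponentially to $\psi_L$; more specifically, $$\psi_L - \sum_{i=1}^{n}\frac1{L_i} = O(\alpha^{-n}),$$ and the ratio of consecutive tails satisfies $$\frac{\psi_L - \sum_{i=1}^{n+1} 1/L_i}{\psi_L - \sum_{i=1}^{n} 1/L_i} \longrightarrow \frac1\alpha \qquad (n\to\infty)$$ (numerically $1/\alpha\approx 0.618$).
   Context: $L_n$ ($n\ge1$) are the Lucas numbers: $L_1=1$, $L_2=3$, $L_n=L_{n-1}+L_{n-2}$ for $n\ge3$. $\alpha = \frac{1+\sqrt5}{2}$ is the golden ratio. *)

(* Defs.v *)
From mathcomp Require Import all_boot all_order all_algebra.
From mathcomp Require Import all_classical all_reals all_analysis.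

Set Implicit Arguments.
Unset Strict Implicit.
Unset Printing Implicit Defensive.

Import Order.TTheory GRing.Theory Num.Theory.
Import numFieldNormedType.Exports.

Local Open Scope classical_set_scope.
Local Open Scope ring_scope.

(* The Lucas sequence is only used from index 1 on (L_1 = 1, L_2 = 3); L_0 = 2
   is the value for which the recurrence already holds at index 2. *)
Fixpoint lucas (n : nat) : nat :=
  match n with
  | 0 => 2
  | 1 => 1
  | (m.+1 as k).+1 => lucas k + lucas m
  end.

Definition golden_ratio (R : realType) : R := (1 + Num.sqrt 5) / 2.

Definition lucas_recip_sum (R : realType) (n : nat) : R :=
  \sum_(1 <= i < n.+1) 1 / (lucas i)%:R.

(* [limn] is total, with an arbitrary default value for divergent sequences:
   convergence has to be asserted separately. *)
Definition psiL (R : realType) : R := limn (lucas_recip_sum R).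

(* Main.v *)
Require Import Defs.
From mathcomp Require Import all_boot all_order all_algebra.
From mathcomp Require Import all_classical all_reals all_analysis.
From mathcomp Require Import ring lra.

Set Implicit Arguments.
Unset Strict Implicit.
Unset Printing Implicit Defensive.

Import Order.TTheory GRing.Theory Num.Theory.
Import numFieldNormedType.Exports.

Local Open Scope classical_set_scope.
Local Open Scope ring_scope.

(** Write [q] for the inverse of the golden ratio, the positive root of
    [q ^+ 2 = 1 - q], and [s n] for the partial sums.

    Since [golden_ratio R ^+ n <= lucas n.+1], the increments of [s] satisfy
    [s n.+1 - s n <= q ^+ n], and [q ^+ n = (q ^+ n - q ^+ n.+1) / (1 - q)]
    telescopes.  Hence [s] converges and its tails are at most
    [q ^+ n / (1 - q)] ([nondecreasing_geometric_increments]), which is the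
    exponential rate.

    For the ratio of tails, the point is that the ratio of consecutive tails
    of a convergent positive series inherits the limit of the ratio of
    consecutive terms ([cvg_tail_ratio]).  The terms here have ratio
    [lucas n.+1 / lucas n.+2], which tends to [q] because
    [lucas n - q * lucas n.+1] is geometric with ratio [- q]
    ([lucas_golden_defect]): multiplying by [- q] is what the Lucas recurrence
    does to this combination, which eliminates the dominant root.

    The numerical value of [q] is read off from its quadratic equation. *)

(** * Tails of monotone sequences *)

(** With [d i = s i.+1 - s i > 0], the hypothesis on the ratios says that
    [`|d i.+1 - q * d i| <= e * d i] for [i] large.  This estimate is additive:
    summing it over [n <= i < n + k] and letting [k] go to infinity gives the
    same estimate for the tails [l - s n.+1] and [l - s n]. *)
Lemma cvg_tail_ratio (R : realType) (s : R^nat) (l q : R) :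
  (forall n, s n < s n.+1) ->
  s n @[n --> \oo] --> l ->
  (s n.+2 - s n.+1) / (s n.+1 - s n) @[n --> \oo] --> q ->
  (l - s n.+1) / (l - s n) @[n --> \oo] --> q.
Proof.
move=> s_lt s_cvg ratio_cvg.
have s_nd : nondecreasing_seq s by apply/nondecreasing_seqP => n; exact: ltW.
have tail_gt0 n : 0 < l - s n.
  rewrite subr_gt0 (lt_le_trans (s_lt n)) //.
  rewrite -(cvg_lim _ s_cvg) //; apply: nondecreasing_cvgn_le => //.
  by apply: cvgP s_cvg.
apply/cvgrPdist_le => e e0.
have [N _ ratioN] := (cvgrPdist_le _ _).1 ratio_cvg e e0.
exists N => // n /= leNn.
have partial k :
    `|(s (n + k).+1%N - s n.+1) - q * (s (n + k)%N - s n)|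
      <= e * (s (n + k)%N - s n).
  elim: k => [|k IHk]; first by rewrite addn0 !subrr mulr0 subr0 normr0 mulr0.
  rewrite addnS; set m := (n + k)%N in IHk *.
  have d0 : 0 < s m.+1 - s m by rewrite subr_gt0.
  have step : `|(s m.+2 - s m.+1) - q * (s m.+1 - s m)| <= e * (s m.+1 - s m).
    have := ratioN m (leq_trans leNn (leq_addr k n)).
    rewrite distrC -(ler_pM2r d0); apply: le_trans.
    rewrite -[X in _ <= _ * X]gtr0_norm // -normrM mulrBl divfK //.
    by rewrite gt_eqF.
  have -> : s m.+2 - s n.+1 - q * (s m.+1 - s n) =
      (s m.+1 - s n.+1 - q * (s m - s n))
      + (s m.+2 - s m.+1 - q * (s m.+1 - s m)) by ring.
  have -> : e * (s m.+1 - s n) = e * (s m - s n) + e * (s m.+1 - s m) by ring.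
  by apply: le_trans (ler_normD _ _) _; exact: lerD.
have s_shift (j : nat) : s (j + k)%N @[k --> \oo] --> l.
  by under eq_fun do rewrite addnC; move: s_cvg; rewrite -(cvg_shiftn j).
have tail_defect : `|(l - s n.+1) - q * (l - s n)| <= e * (l - s n).
  apply: (ler_cvg_to
    (f := fun k => `|(s (n.+1 + k)%N - s n.+1) - q * (s (n + k)%N - s n)|)
    (g := fun k => e * (s (n + k)%N - s n)) (a := \oo)).
  - apply: cvg_norm; apply: cvgB; first by apply: cvgB; [|exact: cvg_cst].
    by apply: cvgMl_tmp; apply: cvgB; [|exact: cvg_cst].
  - by apply: cvgMl_tmp; apply: cvgB; [|exact: cvg_cst].
  - by apply: nearW => k; rewrite addSn.
rewrite distrC -(ler_pM2r (tail_gt0 n)).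
rewrite -[X in _ * X <= _]gtr0_norm // -normrM mulrBl divfK //.
by rewrite gt_eqF.
Qed.

(** Adding the geometric tail [q ^+ n / (1 - q)] to [s n] makes the sequence
    nonincreasing, so these corrected values bound the limit from above. *)
Lemma nondecreasing_geometric_increments (R : realType) (s : R^nat) (q : R) :
  0 <= q < 1 ->
  (forall n, s n <= s n.+1 <= s n + q ^+ n) ->
  cvgn s /\ forall n, 0 <= limn s - s n <= q ^+ n / (1 - q).
Proof.
move=> /andP[q0 q1] s_incr.
have s_nd : nondecreasing_seq s.
  by apply/nondecreasing_seqP => n; case/andP: (s_incr n).
pose t n := s n + q ^+ n / (1 - q).
have t_ni : nonincreasing_seq t.
  apply/nonincreasing_seqP => n; rewrite /t.
  have -> : q ^+ n / (1 - q) = q ^+ n + q ^+ n.+1 / (1 - q).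
    by rewrite exprS; field; rewrite subr_eq0 gt_eqF.
  by rewrite addrA lerD2r; case/andP: (s_incr n).
have le_st n m : s m <= t n.
  have st k : s k <= t k.
    by rewrite lerDl divr_ge0 ?exprn_ge0 // subr_ge0 ltW.
  apply: (le_trans (s_nd _ _ (leq_maxr n m))).
  exact: le_trans (st _) (t_ni _ _ (leq_maxl n m)).
have s_cvg : cvgn s.
  apply: nondecreasing_is_cvgn => //.
  by exists (t 0%N) => _ [m _ <-]; exact: le_st.
split=> // n; rewrite subr_ge0 nondecreasing_cvgn_le //=.
rewrite lerBlDl; apply: limr_le => //.
by apply: nearW => m; exact: le_st.
Qed.

(** * The golden ratio and Lucas numbers *)

Section Golden.
Variable R : realType.
Local Notation q := ((golden_ratio R)^-1).

Lemma golden_ratio_gt0 : 0 < golden_ratio R.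
Proof. by rewrite divr_gt0 // ltr_pwDl // sqrtr_ge0. Qed.

Lemma golden_ratio_sq : golden_ratio R ^+ 2 = golden_ratio R + 1.
Proof.
have h5 : Num.sqrt 5 ^+ 2 = 5 :> R by rewrite sqr_sqrtr.
by rewrite /golden_ratio; lra.
Qed.

Lemma goldenV_gt0 : 0 < q. Proof. by rewrite invr_gt0 golden_ratio_gt0. Qed.

Lemma goldenV_sq : q ^+ 2 = 1 - q.
Proof.
have a0 : golden_ratio R != 0 by rewrite gt_eqF // golden_ratio_gt0.
apply: (mulIf (expf_neq0 2 a0)); rewrite -exprMn mulVf // expr1n.
by rewrite mulrBl {2}expr2 mulKf // golden_ratio_sq; ring.
Qed.

Lemma goldenV_lt1 : q < 1.
Proof. by rewrite -subr_gt0 -goldenV_sq exprn_gt0 // goldenV_gt0. Qed.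

Lemma goldenV_approx : `|q - 618 / 1000| <= 1 / 2000.
Proof.
have := goldenV_sq; have := goldenV_gt0; set x := q => x0 x2.
by rewrite ler_distl; apply/andP; split; nra.
Qed.

Lemma lucas_gt0 n : (0 < lucas n)%N.
Proof.
suff /andP[] : (0 < lucas n)%N && (0 < lucas n.+1)%N by [].
elim: n => // n /andP[h1 h2]; rewrite h2 /= addn_gt0.
by move: h2 => /= ->.
Qed.

Lemma lucasSS n : lucas n.+2 = (lucas n.+1 + lucas n)%N.
Proof. by []. Qed.

Lemma expr_golden_ratio_le_lucas n : golden_ratio R ^+ n <= (lucas n.+1)%:R.
Proof.
suff /andP[] : (golden_ratio R ^+ n <= (lucas n.+1)%:R) &&
   (golden_ratio R ^+ n.+1 <= (lucas n.+2)%:R) by [].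
elim: n => [|n /andP[h1 h2]].
  rewrite expr0 expr1 lexx /=.
  have := golden_ratio_sq; have := golden_ratio_gt0; nra.
rewrite h2 andTb lucasSS natrD -[in X in X <= _]addn2 exprD golden_ratio_sq.
by rewrite mulrDr mulr1 -exprSr; exact: lerD.
Qed.

(** [lucas] is a combination of the powers of [golden_ratio R] and [- q];
    [x n - q * x n.+1] kills the first kind and keeps the second. *)
Lemma lucas_golden_defect n :
  (lucas n)%:R - q * (lucas n.+1)%:R = (2 - q) * (- q) ^+ n.
Proof.
elim: n => [|n IHn]; first by rewrite expr0 !mulr1.
rewrite exprS mulrCA -IHn lucasSS natrD.
have := goldenV_sq; set x := q => x2.
have -> : - x * ((lucas n)%:R - x * (lucas n.+1)%:R) =
  x ^+ 2 * (lucas n.+1)%:R - x * (lucas n)%:R by ring.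
by rewrite x2; ring.
Qed.

Lemma cvg_lucas_ratio :
  (lucas n.+1)%:R / (lucas n.+2)%:R @[n --> \oo] --> q.
Proof.
have q0 := goldenV_gt0; have q1 := goldenV_lt1.
have bound n : `|(lucas n.+1)%:R / (lucas n.+2)%:R - q| <= 2 * q ^+ n.
  have L0 : (0 : R) < (lucas n.+2)%:R by rewrite ltr0n lucas_gt0.
  have L1 : (1 : R) <= (lucas n.+2)%:R by rewrite ler1n lucas_gt0.
  have -> : (lucas n.+1)%:R / (lucas n.+2)%:R - q =
      ((lucas n.+1)%:R - q * (lucas n.+2)%:R) / (lucas n.+2)%:R.
    by rewrite mulrBl mulfK // gt_eqF.
  rewrite lucas_golden_defect normrM normfV (gtr0_norm L0) ler_pdivrMr //.
  rewrite normrM normrX normrN (gtr0_norm q0) gtr0_norm; last by lra.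
  have qn0 : 0 <= q ^+ n by rewrite exprn_ge0 // ltW.
  rewrite -mulrA ler_pM ?exprn_ge0 ?(ltW q0) //; [by lra|by lra|].
  rewrite exprS; apply: (@le_trans _ _ (q ^+ n)).
    by rewrite ler_piMl // ltW.
  by rewrite ler_peMr.
apply/cvgrPdist_le => e e0.
have geom0 : 2 * q ^+ n @[n --> \oo] --> (0 : R).
  rewrite -[X in _ --> X](mulr0 2).
  by apply: cvgMl_tmp; apply: cvg_expr; rewrite (gtr0_norm q0).
apply: filterS ((cvgrPdist_le _ _).1 geom0 e e0) => n /=.
rewrite sub0r normrN => /(le_trans (ler_norm _)); rewrite distrC.
exact: le_trans (bound n).
Qed.

(** * Partial sums of the reciprocals *)

Lemma lucas_recip_sumS n :
  lucas_recip_sum R n.+1 = lucas_recip_sum R n + (lucas n.+1)%:R^-1.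
Proof. by rewrite /lucas_recip_sum big_nat_recr //= div1r. Qed.

Lemma lucas_recip_sum_diff n :
  lucas_recip_sum R n.+1 - lucas_recip_sum R n = (lucas n.+1)%:R^-1.
Proof. by rewrite lucas_recip_sumS addrAC subrr add0r. Qed.

Lemma lucas_recip_sum_lt n : lucas_recip_sum R n < lucas_recip_sum R n.+1.
Proof. by rewrite lucas_recip_sumS ltrDl invr_gt0 ltr0n lucas_gt0. Qed.

Lemma lucas_recip_sum_increment n :
  lucas_recip_sum R n <= lucas_recip_sum R n.+1 <= lucas_recip_sum R n + q ^+ n.
Proof.
rewrite ltW ?lucas_recip_sum_lt //= lucas_recip_sumS lerD2l exprVn.
by rewrite lef_pV2 ?expr_golden_ratio_le_lucas // posrE
  ?exprn_gt0 ?golden_ratio_gt0 // ltr0n lucas_gt0.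
Qed.

End Golden.

Theorem corollary4p11 (R : realType) :
  [/\ lucas_recip_sum R n @[n --> \oo] --> psiL R,
      (fun n : nat => psiL R - lucas_recip_sum R n)
        =O_\oo (fun n : nat => golden_ratio R ^- n),
      (psiL R - lucas_recip_sum R n.+1) / (psiL R - lucas_recip_sum R n)
        @[n --> \oo] --> 1 / golden_ratio R
    & `|1 / golden_ratio R - 618 / 1000| <= 1 / 2000].
Proof.
rewrite div1r.
have q0 := goldenV_gt0 R; have q1 := goldenV_lt1 R.
have q01 : 0 <= (golden_ratio R)^-1 < 1 by rewrite q1 ltW.
have [s_cvg tail_le] :=
  nondecreasing_geometric_increments q01 (@lucas_recip_sum_increment R).
split; [exact: s_cvg | | | exact: goldenV_approx].
- apply/eqOP; exists (1 - (golden_ratio R)^-1)^-1; split; first exact: num_real.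
  move=> k /ltW lek; apply: nearW => n /=.
  have /andP[tail0 tailq] := tail_le n.
  rewrite ger0_norm // -exprVn ger0_norm ?exprn_ge0 ?(ltW q0) //.
  by rewrite (le_trans tailq) // mulrC ler_wpM2r ?exprn_ge0 ?(ltW q0).
- apply: (@cvg_tail_ratio R (lucas_recip_sum R)) s_cvg _.
    exact: lucas_recip_sum_lt.
  under eq_fun do rewrite !lucas_recip_sum_diff invrK mulrC.
  exact: cvg_lucas_ratio.
Qed.
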